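(* Let $n \ge 1$ be an integer and let $\delta, \varepsilon, \lambda$ be positive real numbers with $\delta < \frac{1}{3}$. Then there exists a real number $r > 0$, depending only on $n$, $\delta$, $\varepsilon$ and $\lambda$, such that every lattice $L \subseteq \mathbb{R}^n$ with $\lambda_1(L) \ge \lambda$ satisfies the following condition: for any $x \in \operatorname{span}(L)$ such that $|u\,x|_{\mathbb{Z}} \le \delta$ for all $u \in L \cap rB$, there is a $y \in L'$ such that $\|x - y\| \le \varepsilon$.
   Context: A lattice in $\mathbb{R}^n$ is a discrete additive subgroup $L$ of $\mathbb{R}^n$ (not necessarily of full rank). $\operatorname{span}(L)$ is the real linear subspace of $\mathbb{R}^n$ generated by $L$. $u\,x = u_1x_1+\ldots+u_nx_n$ is the usual inner product, $\|x\| = \sqrt{x\,x}$ is the euclidean norm, and $B = \{x \in \mathbb{R}^n : \|x\| \le 1\}$ is the euclidean unit ball. For $a \in \mathbb{R}$, $|a|_{\mathbb{Z}} = \min_{c \in \mathbb{Z}} |a - c|$ is the distance of $a$ from the integers. $\lambda_1(L) = \inf\{\|x\| : 0 \ne x \in L\}$ is the first Minkowski successive minimum of $L$; thus $\lambda_1(L) \ge \lambda$ means that every nonzero vector of $L$ has norm at least $\lambda$. The dual lattice of $L$ is $L' = \{x \in \operatorname{span}(L) : u\,x \in \mathbb{Z} \text{ for all } u \in L\}$. *)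

(* Defs.v *)
From mathcomp Require Import all_boot all_order all_algebra.
From mathcomp Require Import all_classical all_reals all_analysis.

Set Implicit Arguments.
Unset Strict Implicit.
Unset Printing Implicit Defensive.

Import Order.TTheory GRing.Theory Num.Theory.
Import numFieldNormedType.Exports.

Local Open Scope classical_set_scope.
Local Open Scope ring_scope.

(* The library norm on 'rV[R]_n is the sup norm, hence the definitions of the
   Euclidean inner product, norm and ball below. *)
Definition inner (R : realType) (n : nat) (u x : 'rV[R]_n) : R :=
  \sum_(i < n) u ord0 i * x ord0 i.

Definition enorm (R : realType) (n : nat) (x : 'rV[R]_n) : R :=
  Num.sqrt (inner x x).

Definition unit_ball (R : realType) (n : nat) : set 'rV[R]_n :=
  [set x | enorm x <= 1].

(* |a|_Z; the infimum is a minimum, see distZ_min. *)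
Definition distZ (R : realType) (a : R) : R :=
  inf [set `|a - c%:~R| | c in [set: int]].

(* Discreteness refers to the topology of 'rV[R]_n, i.e. the product topology,
   which is the Euclidean one. *)
Record is_lattice (R : realType) (n : nat) (L : set 'rV[R]_n) : Prop := {
  lattice_0 : L 0;
  lattice_B : forall x y, L x -> L y -> L (x - y);
  lattice_discrete : L `<=` isolated L }.

Definition real_span (R : realType) (n : nat) (L : set 'rV[R]_n) :
    set 'rV[R]_n :=
  [set x | forall V : {vspace 'rV[R]_n}, (forall v, L v -> v \in V) -> x \in V].

(* Extended-real valued: the zero lattice has lambda1 = +oo. *)
Definition lambda1 (R : realType) (n : nat) (L : set 'rV[R]_n) : \bar R :=
  ereal_inf [set (enorm x)%:E | x in [set x | x != 0 /\ L x]].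

Definition dual_lattice (R : realType) (n : nat) (L : set 'rV[R]_n) :
    set 'rV[R]_n :=
  [set x | real_span L x /\ forall u, L u -> inner u x \is a Num.int].

Lemma distZ_min (R : realType) (a : R) :
  (exists c : int, distZ a = `|a - c%:~R|) /\
  forall c : int, distZ a <= `|a - c%:~R|.
Proof.
set S := [set `|a - c%:~R| | c in [set: int]].
have lbS : has_lbound S by exists 0 => _ [c _ <-].
have S0 : S !=set0 by exists `|a - 0%:~R|, 0.
split; last by move=> c; apply: ge_inf => //; exists c.
have minS (d : int) : (forall c : int, `|a - d%:~R| <= `|a - c%:~R|) ->
    distZ a = `|a - d%:~R|.
  move=> Hd; apply/eqP; rewrite eq_le; apply/andP; split.
    by apply: ge_inf => //; exists d.
  by apply: lb_le_inf => // _ [c _ <-].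
set m := Num.floor a.
have am : 0 <= a - m%:~R by rewrite subr_ge0 floor_le.
have am1 : a - (m + 1)%:~R <= 0 by rewrite subr_le0 ltW // floorD1_gt.
have Hlt (c : int) : c <= m -> `|a - m%:~R| <= `|a - c%:~R|.
  move=> cm; have cm' : (c%:~R : R) <= m%:~R by rewrite ler_int.
  by rewrite !ger0_norm ?lerD2l ?lerN2 // (le_trans am) // lerD2l lerN2.
have Hgt (c : int) : m < c -> `|a - (m + 1)%:~R| <= `|a - c%:~R|.
  rewrite -lezD1 => cm; have cm' : ((m + 1)%:~R : R) <= c%:~R by rewrite ler_int.
  by rewrite !ler0_norm ?lerN2 ?lerD2l ?lerN2 // (le_trans _ am1) // lerD2l lerN2.
have [h|h] := leP `|a - m%:~R| `|a - (m + 1)%:~R|.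
  exists m; apply: minS => c; have [/Hlt//|/Hgt] := leP c m; exact: le_trans.
exists (m + 1); apply: minS => c; have [/Hlt|/Hgt//] := leP c m.
exact/le_trans/ltW.
Qed.

(* Main.v *)
Require Import Defs.
From mathcomp Require Import all_boot all_order all_algebra.
From mathcomp Require Import all_classical all_reals all_analysis.
From HB Require Import structures.
From mathcomp Require Import ring lra zify.

Set Implicit Arguments.
Unset Strict Implicit.
Unset Printing Implicit Defensive.

Import Order.TTheory GRing.Theory Num.Theory.
Import numFieldNormedType.Exports.
Local Open Scope classical_set_scope.
Local Open Scope ring_scope.

(** The hypothesis on small vectors amplifies itself: if a and 2a are both within
    delta < 1/3 of an integer, then a is within delta / 2 of one ([distZ_half]).
    So if r is 2^k times larger than s, then the pairing with x is within
    delta / 2^k of an integer on all u in L of norm at most s ([distZ_pow2]).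
    What is left is the stability statement [character_near_inner]: for suitable
    s and eta, closeness eta on vectors of size at most s already provides a
    small e in the span of L with u (x - e) integral for all u in L; then
    y = x - e is the required dual vector.

    That statement is proved by induction on the dimension of the span. Let u be
    an almost shortest nonzero vector of L, and project L along u onto its
    orthogonal complement; the projected lattice is again bounded away from 0
    ([proj_short]). If t is the signed distance of u x from a suitable integer,
    the correction e = e1 + (t / u u) u, with e1 orthogonal to u, pairs with u
    to t, and e1 is supplied by the induction hypothesis. Its second term has
    norm |t| / |u|, which is small for one of two reasons: either u is short and
    the hypothesis makes t small, or u is long. In the second case the whole
    projected lattice has only long nonzero vectors, so the hypothesis on it is
    vacuous, up to the zero vector.

    Fixing the pairing with u changes what is asked of the projected lattice: its
    vectors w must pair with e1 to u' x - a t modulo integers, where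
    u' = w + a u is any lift of w to L. This need not be the pairing with the
    projection of x, and to realise it as the pairing with some vector would
    require a basis of the lattice. The induction is therefore stated for an
    arbitrary character of L, that is, a real function which is additive modulo
    integers, and the vector e representing it modulo integers is produced by the
    induction itself. *)

(** * Inner product and projection along a vector *)

Section Inner.
Context {R : realType} {n : nat}.
Implicit Types (u v w x : 'rV[R]_n) (a : R).

Lemma innerC u v : inner u v = inner v u.
Proof. by apply: eq_bigr => i _; rewrite mulrC. Qed.

Lemma inner_is_linear u : linear (inner u : 'rV[R]_n -> R^o).
Proof.
move=> a v w; rewrite /inner scaler_sumr -big_split /=; apply: eq_bigr => i _.
by rewrite !mxE mulrDr /GRing.scale /= mulrCA.
Qed.

HB.instance Definition _ u :=
  GRing.isLinear.Build R 'rV[R]_n R^o _ (inner u) (inner_is_linear u).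

Lemma innerDr u v w : inner u (v + w) = inner u v + inner u w.
Proof. exact: linearD. Qed.

Lemma innerBr u v w : inner u (v - w) = inner u v - inner u w.
Proof. exact: linearB. Qed.

Lemma innerZr a u v : inner u (a *: v) = a * inner u v.
Proof. exact: linearZ. Qed.

Lemma innerDl u v w : inner (v + w) u = inner v u + inner w u.
Proof. by rewrite !(innerC _ u) innerDr. Qed.

Lemma innerBl u v w : inner (v - w) u = inner v u - inner w u.
Proof. by rewrite !(innerC _ u) innerBr. Qed.

Lemma innerZl a u v : inner (a *: v) u = a * inner v u.
Proof. by rewrite !(innerC _ u) innerZr. Qed.

Lemma inner0r u : inner u 0 = 0.
Proof. exact: linear0. Qed.

Lemma inner_ge0 v : 0 <= inner v v.
Proof. by apply: sumr_ge0 => i _; rewrite -expr2 sqr_ge0. Qed.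

Lemma inner_gt0 v : (0 < inner v v) = (v != 0).
Proof.
apply/idP/idP; first by apply: contraTneq => ->; rewrite inner0r ltxx.
apply: contraNT; rewrite -leNgt => v0; apply/eqP/rowP => i; rewrite mxE.
have /eqP : inner v v = 0 by apply/eqP; rewrite eq_le v0 inner_ge0.
rewrite psumr_eq0 => [/allP /(_ i (mem_index_enum _))|j _].
  by rewrite mulf_eq0 orbb => /eqP.
by rewrite -expr2 sqr_ge0.
Qed.

Lemma enorm_le v a : 0 <= a -> (enorm v <= a) = (inner v v <= a ^+ 2).
Proof.
move=> a0; rewrite /enorm.
by rewrite -{1}(ger0_norm a0) -sqrtr_sqr ler_sqrt// sqr_ge0.
Qed.

Definition coef u v : R := inner u v / inner u u.

Definition oproj u v : 'rV[R]_n := v - coef u v *: u.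

Lemma coefB u v w : coef u (v - w) = coef u v - coef u w.
Proof. by rewrite /coef innerBr mulrBl. Qed.

Lemma oprojB u v w : oproj u (v - w) = oproj u v - oproj u w.
Proof. by rewrite /oproj coefB scalerBl !opprD !opprK addrACA. Qed.

Lemma coefZ u (u0 : u != 0) a : coef u (a *: u) = a.
Proof. by rewrite /coef innerZr mulfK// gt_eqF// inner_gt0. Qed.

Lemma inner_oproj u v : u != 0 -> inner u (oproj u v) = 0.
Proof.
move=> u0; rewrite innerBr innerZr /coef divfK ?subrr//.
by rewrite gt_eqF// inner_gt0.
Qed.

Lemma pythagoras u v a : inner u v = 0 ->
  inner (v + a *: u) (v + a *: u) = inner v v + a ^+ 2 * inner u u.
Proof.
by move=> uv; rewrite innerDl !innerDr !innerZl !innerZr (innerC v u) uv; ring.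
Qed.

End Inner.

(** * Subgroups and their characters *)

Lemma int_eq (R : realType) (a b : R) :
  a = b -> a \is a Num.int -> b \is a Num.int.
Proof. by move=> ->. Qed.

Section Subgroup.
Context {R : realType} {n : nat}.
Implicit Types (u v w x : 'rV[R]_n) (a : R) (L : set 'rV[R]_n).

Definition is_subgroup L := L 0 /\ forall u v, L u -> L v -> L (u - v).

Lemma subgroupN L u : is_subgroup L -> L u -> L (- u).
Proof. by move=> [L0 LB] Lu; rewrite -sub0r; exact: LB. Qed.

Lemma subgroupD L u v : is_subgroup L -> L u -> L v -> L (u + v).
Proof.
by move=> LG Lu Lv; rewrite -[v]opprK; apply: LG.2 => //; exact: subgroupN.
Qed.

Lemma subgroupMn L u k : is_subgroup L -> L u -> L (u *+ k).
Proof.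
move=> LG Lu; elim: k => [|k IH]; first by rewrite mulr0n; exact: LG.1.
by rewrite mulrS; exact: subgroupD.
Qed.

Lemma subgroupMz L u (k : int) : is_subgroup L -> L u -> L (u *~ k).
Proof.
move=> LG Lu; case: k => k; first by rewrite -pmulrn; exact: subgroupMn.
by rewrite NegzE mulrNz -pmulrn; apply: subgroupN => //; exact: subgroupMn.
Qed.

(** A homomorphism from L to R / Z, given by real representatives. *)
Definition is_character L (chi : 'rV[R]_n -> R) :=
  forall u v, L u -> L v -> chi (u - v) - (chi u - chi v) \is a Num.int.

Section Character.
Variables (L : set 'rV[R]_n) (chi : 'rV[R]_n -> R).
Hypotheses (LG : is_subgroup L) (chiP : is_character L chi).

Lemma character0 : chi 0 \is a Num.int.
Proof.
by have := chiP LG.1 LG.1; rewrite !subrr subr0.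
Qed.

Lemma characterN u : L u -> chi (- u) + chi u \is a Num.int.
Proof.
move=> Lu; have := rpredD (chiP LG.1 Lu) character0.
by rewrite sub0r opprB addrA subrK.
Qed.

Lemma characterMn u k : L u -> chi (u *+ k) - k%:R * chi u \is a Num.int.
Proof.
move=> Lu; elim: k => [|k IH]; first by rewrite mulr0n mul0r subr0 character0.
have Lk := subgroupMn k LG Lu.
have := rpredD (chiP Lk (subgroupN LG Lu)) (rpredB IH (characterN Lu)).
by apply: int_eq; rewrite opprK -mulrSr -[k.+1%:R]natr1; ring.
Qed.

Lemma characterMz u (k : int) : L u -> chi (u *~ k) - k%:~R * chi u \is a Num.int.
Proof.
move=> Lu; case: k => k; first by rewrite -!pmulrn; exact: characterMn.
rewrite NegzE !mulrNz -!pmulrn.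
have := rpredB (characterN (subgroupMn k.+1 LG Lu)) (characterMn k.+1 Lu).
by apply: int_eq; ring.
Qed.

End Character.

(** An infimum that need not be attained is enough for the sequel: any factor
    below 4 prevents u / 2 from lying in L and keeps the projection of L along u
    bounded away from 0. *)
Lemma almost_shortest L lambda : 0 < lambda ->
  (forall v, L v -> v != 0 -> lambda <= inner v v) ->
  (exists2 v, L v & v != 0) ->
  exists u, [/\ L u, u != 0 &
    forall v, L v -> v != 0 -> inner u u <= 2 * inner v v].
Proof.
move=> l0 Ll [v0 Lv0 v00].
pose A := [set inner v v | v in [set v | L v /\ v != 0]].
have A0 : A !=set0 by exists (inner v0 v0), v0.
have Alb : lbound A lambda by move=> _ [v [Lv vn0] <-]; exact: Ll.
have infA : lambda <= inf A by exact: lb_le_inf.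
have [|_ [u [Lu un0] <-] uA] := @inf_adherent _ A (inf A) (lt_le_trans l0 infA).
  by split=> //; exists lambda.
exists u; split=> // v Lv vn0.
have : inf A <= inner v v by apply: ge_inf; [exists lambda|exists v].
lra.
Qed.

(** The projection of V along u lies in the part of V orthogonal to u, which does
    not contain u. *)
Lemma dim_oproj_lt (V : {vspace 'rV[R]_n}) u : u \in V -> u != 0 ->
  exists W : {vspace 'rV[R]_n}, (\dim W < \dim V)%N /\
    forall v, v \in V -> oproj u v \in W.
Proof.
move=> uV u0; pose f := linfun (inner u : 'rV[R]_n -> R^o).
exists (V :&: lker f)%VS; split=> [|v vV]; last first.
  rewrite memv_cap memv_ker lfunE /= inner_oproj// eqxx andbT.
  by rewrite memvB// memvZ.
rewrite ltn_neqAle dimvS ?capvSl// andbT.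
apply: contra_neqN u0 => /eqP e.
have : (V :&: lker f == V)%VS by rewrite eqEdim capvSl e leqnn.
move=> /eqP VE; move: uV; rewrite -VE memv_cap memv_ker lfunE/= => /andP[_ /eqP uu].
by apply/eqP; rewrite -[_ == _]negbK -inner_gt0 uu ltxx.
Qed.

End Subgroup.

(** * Distance to the integers *)

Lemma distZ_le (R : realType) (a d : R) :
  distZ a <= d <-> exists c : int, `|a - c%:~R| <= d.
Proof.
have [[c cE] cmin] := distZ_min a.
by split=> [ad|[c' /(le_trans (cmin c'))]//]; exists c; rewrite -cE.
Qed.

(** If c and c' are the integers near a and 2a, then c' - 2c is an integer of
    absolute value at most 3d < 1, so it vanishes. *)
Lemma distZ_half (R : realType) (a d : R) :
  d < 1 / 3 -> distZ a <= d -> distZ (2 * a) <= d -> distZ a <= d / 2.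
Proof.
move=> d3 /distZ_le[c] ac /distZ_le[c'] ac'; apply/distZ_le; exists c.
move: ac ac'; rewrite !ler_norml => /andP[l1 l2] /andP[l3 l4].
have cc : `|c' - 2 * c| < 1.
  rewrite -(ltr_int R) intr_norm intrB intrM ltr_norml.
  by apply/andP; split; lra.
have {cc}c'E : c' = 2 * c by lia.
by move: l3 l4; rewrite c'E intrM => l3 l4; apply/andP; split; lra.
Qed.

Lemma distZ_pow2 (R : realType) (d : R) k a : 0 <= d -> d < 1 / 3 ->
  (forall j, (j <= k)%N -> distZ (2 ^+ j * a) <= d) -> distZ a <= d / 2 ^+ k.
Proof.
move=> d0 d3; elim: k a => [|k IH] a ad.
  by have := ad 0 isT; rewrite expr0 mul1r divr1.
rewrite exprS invfM mulrCA mulrC; apply: distZ_half.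
- apply: le_lt_trans d3.
  by rewrite ler_pdivrMr ?ler_peMr ?exprn_ege1 ?exprn_gt0// ler1n.
- by apply: IH => j jk; apply: ad; exact: leqW.
- by apply: IH => j jk; rewrite mulrA -exprSr; exact: ad.
Qed.

Lemma nearest_int (R : realType) (a : R) : exists c : int, `|a - c%:~R| <= 1 / 2.
Proof.
exists (Num.floor (a + 1 / 2)).
have := floor_le (a + 1 / 2); have := floorD1_gt (a + 1 / 2).
by rewrite intrD ler_norml => h1 h2; apply/andP; split; lra.
Qed.

(** * Projecting a lattice along an almost shortest vector *)

Section Step.
Context {R : realType} {n : nat} (L : set 'rV[R]_n) (chi : 'rV[R]_n -> R).
Hypotheses (LG : is_subgroup L) (chiP : is_character L chi).
Variables (u : 'rV[R]_n) (t : R).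
Hypotheses (Lu : L u) (u0 : u != 0).
Hypothesis u_short : forall v, L v -> v != 0 -> inner u u <= 2 * inner v v.
Hypothesis chit : chi u - t \is a Num.int.

Let proj_L := [set oproj u v | v in L].

Let uu : 0 < inner u u. Proof. by rewrite inner_gt0. Qed.

(** The vector u is primitive: a multiple of u in L whose coefficient is not an
    integer could be reduced modulo u to a nonzero vector of at most half the
    length of u. *)
Lemma line_int v : L v -> oproj u v = 0 -> exists k : int, v = u *~ k.
Proof.
move=> Lv /eqP; rewrite subr_eq0 => /eqP ve.
have [k ka] := nearest_int (coef u v); exists k; apply/eqP; rewrite -subr_eq0.
apply: contraPT ka => vk; apply/negP; rewrite -ltNge.
have Lvk : L (v - u *~ k) by apply: LG.2 => //; exact: subgroupMz.
have := u_short Lvk vk; rewrite {1 2}ve -scaler_int -scalerBl innerZl innerZr.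
set a := _ - _; rewrite (mulrA a) -expr2 -(real_normK (num_real a)) => h.
rewrite ltNge; apply/negP => a2; have : `|a| ^+ 2 <= 1 / 4.
  by have := normr_ge0 a; nra.
by rewrite -(ler_pM2r uu) => a4; have := uu; lra.
Qed.

Lemma lift_ex w : proj_L w ->
  exists v, [/\ L v, oproj u v = w & `|coef u v| <= 1 / 2].
Proof.
move=> [v Lv <-]; have [k ka] := nearest_int (coef u v).
exists (v - u *~ k); rewrite oprojB coefB -scaler_int coefZ//; split => //.
  by apply: LG.2 => //; rewrite scaler_int; exact: subgroupMz.
by rewrite /oproj coefZ// subrr subr0.
Qed.

Let lift w := xget 0 [set v | L v /\ oproj u v = w].

(** The character induced by chi on the projected lattice once the pairing with
    u is prescribed to be t; by [proj_charE] it does not depend on the lift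
    modulo integers. *)
Definition proj_char w := chi (lift w) - coef u (lift w) * t.

(** Two lifts differ by k u with k an integer ([line_int]); this changes chi by
    k chi(u) and the coefficient along u by k, and chi(u) = t modulo integers. *)
Lemma proj_charE v : L v ->
  proj_char (oproj u v) - (chi v - coef u v * t) \is a Num.int.
Proof.
move=> Lv; rewrite /proj_char; set v' := lift _.
have [Lv' vv'] : L v' /\ oproj u v' = oproj u v.
  by apply: (@xgetPex _ 0 [set w | L w /\ oproj u w = oproj u v]); exists v.
have [k ke] : exists k : int, v' - v = u *~ k.
  by apply: line_int; [exact: LG.2|rewrite oprojB vv' subrr].
have := chiP Lv' Lv; rewrite ke => h1.
have h2 := characterMz LG chiP k Lu.
have h3 : k%:~R * (chi u - t) \is a Num.int by rewrite rpredM// intr_int.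
have ce : coef u v' = coef u v + k%:~R.
  by have := coefB u v' v; rewrite ke -scaler_int coefZ// => ->; ring.
rewrite ce; have := rpredD (rpredB h2 h1) h3.
by apply: int_eq; ring.
Qed.

Lemma proj_subgroup : is_subgroup proj_L.
Proof.
split.
  exists 0; first exact: LG.1.
  by rewrite /oproj /coef inner0r mul0r scale0r subr0.
by move=> _ _ [v Lv <-] [w Lw <-]; exists (v - w); [exact: LG.2|rewrite oprojB].
Qed.

Lemma proj_character : is_character proj_L proj_char.
Proof.
move=> _ _ [v Lv <-] [w Lw <-]; rewrite -oprojB.
have h1 := proj_charE Lv; have h2 := proj_charE Lw.
have h3 := proj_charE (LG.2 _ _ Lv Lw); have h4 := chiP Lv Lw.
have := rpredD (rpredD h3 (rpredB h2 h1)) h4; rewrite coefB.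
by apply: int_eq; ring.
Qed.

Lemma proj_norm v :
  inner v v = inner (oproj u v) (oproj u v) + coef u v ^+ 2 * inner u u.
Proof. by rewrite -(pythagoras _ (inner_oproj v u0)) /oproj subrK. Qed.

(** A lift v with coefficient at most 1/2 along u has
    |w|^2 >= |v|^2 - |u|^2 / 4 >= |u|^2 / 2 - |u|^2 / 4. *)
Lemma proj_short w : proj_L w -> w != 0 -> inner u u <= 4 * inner w w.
Proof.
move=> /lift_ex [v [Lv <- a2]] w0.
have v0 : v != 0.
  by apply: contraNneq w0 => ->; rewrite /oproj /coef inner0r mul0r scale0r subr0.
have := u_short Lv v0; rewrite (proj_norm v) -(real_normK (num_real (coef u v))).
move: a2 (normr_ge0 (coef u v)); set a := `|_| => a2 a0.
have : a ^+ 2 <= 1 / 4 by nra.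
by rewrite -(ler_pM2r uu); lra.
Qed.

End Step.

(** * Characters that are nearly trivial on short vectors *)

(** A character of L which is close to 0 modulo integers on the short vectors is
    the pairing with a small vector of the span. The space V only
    serves to measure the dimension of L in the induction. All bounds are on
    squared norms, so that orthogonal components simply add up. *)
Lemma character_near_inner (R : realType) (n k : nat) (eps lambda : R) :
  0 < eps -> 0 < lambda ->
  exists s eta : R, [/\ 0 < s, 0 < eta &
    forall (L : set 'rV[R]_n) (chi : 'rV[R]_n -> R) (V : {vspace 'rV[R]_n}),
      is_subgroup L -> is_character L chi ->
      (\dim V <= k)%N -> (forall v, L v -> v \in V) ->
      (forall v, L v -> v != 0 -> lambda <= inner v v) ->
      (forall v, L v -> inner v v <= s -> distZ (chi v) <= eta) ->
      exists e, [/\ real_span L e, inner e e <= eps &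
        forall v, L v -> chi v - inner v e \is a Num.int]].
Proof.
elim: k eps lambda => [|k IH] eps lambda e0 l0.
  exists 1, 1; split=> // L chi V LG chiP; rewrite leqn0 dimv_eq0 => /eqP-> LV _ _.
  exists 0; split; [by move=> W _; exact: mem0v|by rewrite inner0r ltW|].
  move=> v /LV; rewrite memv0 => /eqP ->.
  by rewrite inner0r subr0; exact: character0 LG chiP.
have [||s1 [eta1 [s10 eta10 {}IH]]] := IH (eps / 2) (lambda / 4).
- by rewrite divr_gt0.
- by rewrite divr_gt0.
(* S separates short u from long u. Its first term makes the projected lattice
   have no nonzero vector of squared norm at most s1 when u is long; the second
   makes the correction along u small even if t is only known to be at most 1/2. *)
pose S := 4 * s1 + 2 / eps.
have Se : 2 / eps <= S by rewrite /S; lra.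
have S0 : 0 < S by apply: lt_le_trans Se; rewrite divr_gt0.
(* The bound 1 gives eta^2 <= eta, hence t^2 / |u|^2 <= eps / 2 for short u. *)
pose eta := Num.min (eta1 / 2) (Num.min 1 (lambda * (eps / 2))).
have eta0 : 0 < eta by rewrite !lt_min ltr01 !(divr_gt0,mulr_gt0).
have eta_1 : eta <= eta1 / 2 by rewrite ge_min lexx.
have eta_l : eta ^+ 2 <= lambda * (eps / 2).
  have h1 : eta <= 1 by rewrite !ge_min lexx ?orbT.
  have h2 : eta <= lambda * (eps / 2) by rewrite !ge_min lexx ?orbT.
  by nra.
exists (s1 + S), eta; split=> //; first by rewrite addr_gt0.
move=> L chi V LG chiP Vk LV Ll chis.
have [[v0 Lv0 v00]|L_triv] := pselect (exists2 v, L v & v != 0); last first.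
  exists 0; split; [by move=> W _; exact: mem0v|by rewrite inner0r ltW|].
  move=> v Lv; have -> : v = 0.
    by apply/eqP/negPn/negP => vn0; apply: L_triv; exists v.
  by rewrite inner0r subr0; exact: character0 LG chiP.
have [|u [Lu u0 u_short]] := almost_shortest l0 Ll; first by exists v0.
have uu : 0 < inner u u by rewrite inner_gt0.
have [t [chit te teta]] : exists t, [/\ chi u - t \is a Num.int,
    t ^+ 2 / inner u u <= eps / 2 & inner u u <= S -> `|t| <= eta].
  have [uS|uS] := leP (inner u u) S.
    have /distZ_le[c ct] : distZ (chi u) <= eta by apply: chis => //; lra.
    exists (chi u - c%:~R); split=> //; first by rewrite opprB addrC subrK intr_int.
    rewrite ler_pdivrMr// -(real_normK (num_real _)).
    have := Ll _ Lu u0; have := normr_ge0 (chi u - c%:~R).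
    by move=> t0 lu; nra.
  have [c ct] := nearest_int (chi u).
  exists (chi u - c%:~R); split=> //; first by rewrite opprB addrC subrK intr_int.
  rewrite ler_pdivrMr// -(real_normK (num_real _)).
  have : 2 < eps * inner u u.
    by rewrite -ltr_pdivrMl// mulrC; exact: le_lt_trans uS.
  by have := normr_ge0 (chi u - c%:~R); nra.
have [W [WV projW]] := dim_oproj_lt (LV _ Lu) u0.
have [||||||e1 [Le1 e1e chie1]] :=
    IH [set oproj u v | v in L] (proj_char L chi u t) W.
- exact: proj_subgroup.
- exact: proj_character.
- by rewrite -ltnS; exact: leq_trans Vk.
- by move=> _ [v Lv <-]; apply: projW; exact: LV.
- move=> w Lw w0; have := proj_short LG Lu u0 u_short Lw w0.
  by have := Ll _ Lu u0; lra.
- move=> w Lw ws.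
  have [uS|uS] := leP (inner u u) S; last first.
    have -> : w = 0.
      apply/eqP/negPn/negP => /(proj_short LG Lu u0 u_short Lw).
      have : 0 < 2 / eps by rewrite divr_gt0.
      by move: uS; rewrite /S; lra.
    apply/distZ_le; have /intrP[c ->] := character0
      (proj_subgroup LG u) (proj_character LG chiP Lu u0 u_short chit).
    by exists c; rewrite subrr normr0 ltW.
  have [v [Lv vw va]] := lift_ex LG Lu u0 Lw.
  (* Since u is short, so is the lift v, and the error of the projected
     character is at most eta + |a| |t| <= eta + eta / 2 <= eta1. *)
  have /distZ_le[c vc] : distZ (chi v) <= eta.
    apply: chis => //; rewrite (proj_norm u0 v) vw.
    rewrite -(real_normK (num_real (coef u v))); apply: lerD => //.
    have := normr_ge0 (coef u v); move: va; set a := `|_| => a2 a0.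
    have a1 : a ^+ 2 <= 1 by nra.
    by apply: le_trans uS; rewrite ler_piMl// ltW.
  have /intrP[m mE] := proj_charE LG chiP Lu u0 u_short chit Lv.
  apply/distZ_le; exists (c + m); rewrite -vw intrD.
  have -> : proj_char L chi u t (oproj u v) - (c%:~R + m%:~R) =
      (chi v - c%:~R) - coef u v * t by rewrite -mE; ring.
  apply: le_trans (ler_normB _ _) _; rewrite normrM.
  have := teta uS; have := normr_ge0 t; have := normr_ge0 (coef u v).
  by move: va vc eta_1; nra.
have ue1 : inner u e1 = 0.
  have : e1 \in lker (linfun (inner u : 'rV[R]_n -> R^o)).
    by apply: (Le1 (lker _)) => _ [v Lv <-]; rewrite memv_ker lfunE/= inner_oproj.
  by rewrite memv_ker lfunE/= => /eqP.
exists (e1 + (t / inner u u) *: u); split.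
- move=> U LU; apply: memvD; last by rewrite memvZ ?LU.
  apply: (Le1 U) => _ [v Lv <-].
  by rewrite memvB ?memvZ ?LU.
- rewrite pythagoras//.
  have -> : (t / inner u u) ^+ 2 * inner u u = t ^+ 2 / inner u u.
    by field; rewrite gt_eqF.
  by lra.
- move=> v Lv.
  have := rpredB (chie1 (oproj u v) (ex_intro2 _ _ v Lv erefl))
    (proj_charE LG chiP Lu u0 u_short chit Lv).
  apply: int_eq; rewrite innerBl innerZl ue1 mulr0 subr0 innerDr innerZr.
  by rewrite (innerC v u) /coef; ring.
Qed.

Theorem theorem5p2 (R : realType) (n : nat) (delta eps lambda : R) :
  (1 <= n)%N ->
  0 < delta -> 0 < eps -> 0 < lambda ->
  delta < 1 / 3%:R ->
  exists2 r : R, 0 < r &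
    forall L : set 'rV[R]_n,
      is_lattice L -> (lambda%:E <= lambda1 L)%E ->
      forall x : 'rV[R]_n, real_span L x ->
        (forall u : 'rV[R]_n,
           (L `&` [set r *: v | v in @unit_ball R n]) u ->
           distZ (inner u x) <= delta) ->
        exists2 y : 'rV[R]_n, dual_lattice L y & enorm (x - y) <= eps.
Proof.
move=> _ d0 e0 l0 d3.
have [s [eta [s0 eta0 main]]] := @character_near_inner R n
  (\dim {:'rV[R]_n}) _ _ (exprn_gt0 2 e0) (exprn_gt0 2 l0).
have [k kE] : exists k, delta / 2 ^+ k <= eta.
  exists (Num.bound (delta / eta)).
  rewrite ler_pdivrMr ?exprn_gt0// -ler_pdivrMl// mulrC.
  apply: ltW (lt_le_trans (archi_boundP _) _); first by rewrite divr_ge0 ?ltW.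
  by rewrite -natrX ler_nat ltnW// ltn_expl.
have k1 j : 1 <= 2 ^+ j :> R by rewrite exprn_ege1// ler1n.
(* s bounds squared norms, and s <= (s + 1)^2. *)
pose r := 2 ^+ k * (s + 1).
have r0 : 0 < r by rewrite mulr_gt0 ?addr_gt0// exprn_gt0.
exists r => // L [L0 LB _] Ll x Lx xd.
have LG : is_subgroup L by [].
have chiP : is_character L (fun v => inner v x).
  by move=> u v _ _; rewrite innerBl subrr rpred0.
have [|||e [Le ee xe]] := main L (fun v => inner v x) fullv LG chiP (leqnn _).
- by move=> v _; exact: memvf.
- move=> v Lv v0; rewrite leNgt; apply/negP => lv.
  have : (lambda%:E <= (enorm v)%:E)%E.
    by apply: le_trans Ll _; apply: ereal_inf_lbound; exists v.
  rewrite lee_fin leNgt => /negP; apply.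
  by rewrite /enorm -(ger0_norm (ltW l0)) -sqrtr_sqr ltr_sqrt ?exprn_gt0.
- move=> v Lv vs; apply: le_trans kE; apply: distZ_pow2; [exact: ltW|by []|].
  move=> j jk; rewrite -innerZl; apply: xd; split.
    by rewrite -natrX scaler_nat; exact: subgroupMn.
  exists (r^-1 *: (2 ^+ j *: v)); last by rewrite scalerA divff ?scale1r// gt_eqF.
  rewrite /unit_ball /= enorm_le// expr1n scalerA innerZl innerZr.
  have -> : r^-1 * 2 ^+ j * (r^-1 * 2 ^+ j * inner v v) =
      (2 ^+ j) ^+ 2 * inner v v / r ^+ 2 by field; rewrite gt_eqF.
  rewrite ler_pdivrMr ?exprn_gt0// mul1r exprMn ler_pM ?sqr_ge0 ?inner_ge0//.
    by rewrite ler_sqr ?nnegrE ?(le_trans ler01)// ler_weXn2l// ler1n.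
  by nra.
exists (x - e); last by rewrite opprB addrC subrK enorm_le// ltW.
split; first by move=> V LV; apply: memvB; [exact: Lx|exact: Le].
by move=> u Lu; rewrite innerBr; exact: xe.
Qed.
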